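(* Let $\eta_1,\eta_1'\in\mathbb{K}$ and $\xi_2,\zeta_1,\zeta_2,\xi_2',\zeta_1',\zeta_2'\in\mathbb{K}^*$. Every simple right $A_2^{\underline{q},\Lambda}$-module of type $(M_2,\eta_1,\xi_2,\zeta_1,\zeta_2)$ has $\mathbb{K}$-dimension $l_1l_2$. Moreover, simple modules of types $(M_2,\eta_1,\xi_2,\zeta_1,\zeta_2)$ and $(M_2,\eta_1',\xi_2',\zeta_1',\zeta_2')$ are isomorphic if and only if $\eta_1=\eta_1'$, $\xi_2=\xi_2'$, $\zeta_1=q_1^{-a}\zeta_1'$ and $\zeta_2=q_1^{-a}q_2^{b}\zeta_2'$ for some $0\le a\le l_1-1$ and $0\le b\le l_2-1$.
   Context: $\mathbb{K}$ is an algebraically closed field of arbitrary characteristic. $q_1,q_2\in\mathbb{K}\setminus\{0,1\}$ and $\lambda\in\mathbb{K}^*$, where $q_i$ is a primitive $l_i$-th root of unity ($i=1,2$) and $\lambda^{l_1}=1$. All modules are right modules. $A_2^{\underline{q},\Lambda}$ is the unital associative $\mathbb{K}$-algebra generated by $x_1,y_1,x_2,y_2$ subject to $$x_1x_2=q_1\lambda x_2x_1,\quad x_1y_2=\lambda^{-1}y_2x_1,\quad y_1y_2=\lambda y_2y_1,\quad y_1x_2=q_1^{-1}\lambda^{-1}x_2y_1,$$ $$x_1y_1-q_1y_1x_1=1,\qquad x_2y_2-q_2y_2x_2=1+(q_1-1)y_1x_1.$$ Put $z_i=x_iy_i-y_ix_i$ for $i=1,2$; these are normal elements, so each acts on a simple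 module either as zero or invertibly. The elements $x_1^{l_1},x_2^{l_2},y_1^{l_1},y_2^{l_2},z_1,z_2$ commute with each other. A simple module of type $(M_2,\eta_1,\xi_2,\zeta_1,\zeta_2)$ is a simple right $A_2^{\underline{q},\Lambda}$-module $M$ on which $z_1,z_2$ act invertibly, $x_1$ acts nilpotently and $x_2$ acts invertibly, and which contains a nonzero common eigenvector $w$ of the six commuting elements $x_1^{l_1},x_2^{l_2},y_1^{l_1},y_2^{l_2},z_1,z_2$ such that $$wx_1=0,\quad wx_2^{l_2}=\xi_2w,\quad wy_1^{l_1}=\eta_1w,\quad wz_1=\zeta_1w,\quad wz_2=\zeta_2w$$ (and $wy_2^{l_2}=\eta_2w$ for some $\eta_2\in\mathbb{K}$). Such an $M$ is denoted $(M_2,\eta_1,\xi_2,\zeta_1,\zeta_2)$. *)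

(* Defs.v *)
From HB Require Import structures.
From mathcomp Require Import all_boot all_order all_algebra.
From mathcomp Require Import generic_quotient boolp.
From mathcomp Require Import monalg.

Set Implicit Arguments.
Unset Strict Implicit.
Unset Printing Implicit Defensive.

Import GRing.Theory.
Local Open Scope ring_scope.
Local Open Scope quotient_scope.

(* MathComp's ideal quotients are limited to proper ideals of commutative     *)
(* rings; here is the quotient of an arbitrary ring by a two-sided ideal.     *)
Section TwoSidedQuotient.
Variables (R : nzRingType) (rels : seq R).

Inductive in_ideal : R -> Prop :=
| in_ideal_gen r : r \in rels -> in_ideal r
| in_ideal0 : in_ideal 0
| in_idealD x y : in_ideal x -> in_ideal y -> in_ideal (x + y)
| in_idealMl a x : in_ideal x -> in_ideal (a * x)
| in_idealMr a x : in_ideal x -> in_ideal (x * a).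

Lemma in_idealN x : in_ideal x -> in_ideal (- x).
Proof. by move=> Ix; rewrite -mulN1r; apply: in_idealMl. Qed.

Definition ideal_eq (x y : R) : bool := `[< in_ideal (x - y) >].

Lemma ideal_eqP x y : reflect (in_ideal (x - y)) (ideal_eq x y).
Proof. exact: asboolP. Qed.

Lemma ideal_eq_equiv : equiv_class_of ideal_eq.
Proof.
split=> [x|x y|y x z].
- by apply/ideal_eqP; rewrite subrr; apply: in_ideal0.
- by apply/ideal_eqP/ideal_eqP => /in_idealN; rewrite opprB.
- move=> /ideal_eqP Ixy /ideal_eqP Iyz; apply/ideal_eqP.
  by rewrite -(subrK y x) -addrA; apply: in_idealD.
Qed.

Canonical ideal_eq_equiv_rel := EquivRelPack ideal_eq_equiv.
Canonical ideal_eq_encModRel := defaultEncModRel ideal_eq.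

Definition quo := {eq_quot ideal_eq}.

HB.instance Definition _ : EqQuotient R ideal_eq quo := EqQuotient.on quo.
HB.instance Definition _ := Choice.on quo.

Definition quo_pi (x : R) : quo := \pi_quo x.

Lemma quo_piW (P : quo -> Prop) : (forall x, P (quo_pi x)) -> forall u, P u.
Proof. by move=> Ppi; apply: quotW. Qed.

Lemma quo_eqP x y : quo_pi x = quo_pi y <-> in_ideal (x - y).
Proof.
split=> [/eqP|Ixy]; first by rewrite /quo_pi piE => /ideal_eqP.
by apply/eqP; rewrite /quo_pi piE; apply/ideal_eqP.
Qed.

Lemma in_ideal_repr x : in_ideal (repr (quo_pi x) - x).
Proof. by apply/quo_eqP; rewrite /quo_pi reprK. Qed.

Definition quo_opp (u : quo) : quo := quo_pi (- repr u).
Definition quo_add (u v : quo) : quo := quo_pi (repr u + repr v).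
Definition quo_mul (u v : quo) : quo := quo_pi (repr u * repr v).

Lemma quo_piN x : quo_opp (quo_pi x) = quo_pi (- x).
Proof. by apply/quo_eqP; rewrite -opprD; apply/in_idealN/in_ideal_repr. Qed.

Lemma quo_piD x y : quo_add (quo_pi x) (quo_pi y) = quo_pi (x + y).
Proof.
by apply/quo_eqP; rewrite opprD addrACA; apply: in_idealD; apply: in_ideal_repr.
Qed.

Lemma quo_piM x y : quo_mul (quo_pi x) (quo_pi y) = quo_pi (x * y).
Proof.
apply/quo_eqP; set x' := repr _; set y' := repr _.
have -> : x' * y' - x * y = (x' - x) * y' + x * (y' - y).
  by rewrite mulrBl mulrBr addrA subrK.
by apply: in_idealD; [apply: in_idealMr | apply: in_idealMl];
  apply: in_ideal_repr.
Qed.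

Lemma quo_addA : associative quo_add.
Proof.
by elim/quo_piW=> x; elim/quo_piW=> y; elim/quo_piW=> z; rewrite !quo_piD addrA.
Qed.

Lemma quo_addC : commutative quo_add.
Proof. by elim/quo_piW=> x; elim/quo_piW=> y; rewrite !quo_piD addrC. Qed.

Lemma quo_add0 : left_id (quo_pi 0) quo_add.
Proof. by elim/quo_piW=> x; rewrite quo_piD add0r. Qed.

Lemma quo_addN : left_inverse (quo_pi 0) quo_opp quo_add.
Proof. by elim/quo_piW=> x; rewrite quo_piN quo_piD addNr. Qed.

HB.instance Definition _ :=
  GRing.isZmodule.Build quo quo_addA quo_addC quo_add0 quo_addN.

Lemma quo_mulA : associative quo_mul.
Proof.
by elim/quo_piW=> x; elim/quo_piW=> y; elim/quo_piW=> z; rewrite !quo_piM mulrA.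
Qed.

Lemma quo_mul1l : left_id (quo_pi 1) quo_mul.
Proof. by elim/quo_piW=> x; rewrite quo_piM mul1r. Qed.

Lemma quo_mul1r : right_id (quo_pi 1) quo_mul.
Proof. by elim/quo_piW=> x; rewrite quo_piM mulr1. Qed.

Lemma quo_mulDl : left_distributive quo_mul quo_add.
Proof.
elim/quo_piW=> x; elim/quo_piW=> y; elim/quo_piW=> z.
by rewrite quo_piD !quo_piM quo_piD mulrDl.
Qed.

Lemma quo_mulDr : right_distributive quo_mul quo_add.
Proof.
elim/quo_piW=> x; elim/quo_piW=> y; elim/quo_piW=> z.
by rewrite quo_piD !quo_piM quo_piD mulrDr.
Qed.

HB.instance Definition _ := GRing.Zmodule_isPzRing.Build quo
  quo_mulA quo_mul1l quo_mul1r quo_mulDl quo_mulDr.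

Lemma quo_pi_is_zmod_morphism : zmod_morphism quo_pi.
Proof. by move=> x y; rewrite -quo_piD -quo_piN. Qed.

Lemma quo_pi_is_monoid_morphism : monoid_morphism quo_pi.
Proof. by split=> // x y; rewrite -quo_piM. Qed.

HB.instance Definition _ :=
  GRing.isZmodMorphism.Build R quo quo_pi quo_pi_is_zmod_morphism.
HB.instance Definition _ :=
  GRing.isMonoidMorphism.Build R quo quo_pi quo_pi_is_monoid_morphism.

Lemma quo_pi1 : quo_pi 1 = 1.
Proof. by []. Qed.

Lemma quo_pi_add x y : quo_pi (x + y) = quo_pi x + quo_pi y.
Proof. by rewrite -quo_piD. Qed.

Lemma quo_pi_sub x y : quo_pi (x - y) = quo_pi x - quo_pi y.
Proof. exact: quo_pi_is_zmod_morphism. Qed.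

Lemma quo_pi_mul x y : quo_pi (x * y) = quo_pi x * quo_pi y.
Proof. by rewrite -quo_piM. Qed.

Lemma quo_pi_rel r : r \in rels -> quo_pi r = 0.
Proof. by move=> rel_r; apply/quo_eqP; rewrite subr0; apply: in_ideal_gen. Qed.

End TwoSidedQuotient.

(* A right B-module is a left module over the converse ring B^c.              *)
Definition ract (B : pzRingType) (M : lmodType B^c) (m : M) (b : B) : M :=
  (b : B^c) *: m.

Notation "m <** b" := (ract m b) (at level 40, left associativity) : ring_scope.

Lemma ractM (B : pzRingType) (M : lmodType B^c) (m : M) (a b : B) :
  m <** (a * b) = m <** a <** b.
Proof. by rewrite /ract scalerA. Qed.

Section RightModules.
Variables (B : pzRingType) (M : lmodType B^c).

Definition simple_module : Prop :=
  (exists m : M, m != 0) /\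
  (forall S : {pred M}, submod_closed S -> S =i pred1 0 \/ S =i predT).

Definition acts_invertibly (b : B) : Prop := bijective (fun m : M => m <** b).

Definition acts_nilpotently (b : B) : Prop :=
  exists n : nat, forall m : M, m <** b ^+ n = 0.

End RightModules.

Definition module_iso (B : pzRingType) (M N : lmodType B^c) : Prop :=
  exists f : {linear M -> N}, bijective f.

Section QuantizedWeyl.
Variables (K : fieldType) (q1 q2 lam : K).

Definition freeAlg := {malg K[{fmonom 'I_4}]}.

Definition gen (i : 'I_4) : freeAlg := << fmu i >>.

Let X1 := gen (@Ordinal 4 0 isT).
Let Y1 := gen (@Ordinal 4 1 isT).
Let X2 := gen (@Ordinal 4 2 isT).
Let Y2 := gen (@Ordinal 4 3 isT).

Definition weyl_rels : seq freeAlg :=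
  [:: X1 * X2 - (q1 * lam) *: (X2 * X1);
      X1 * Y2 - lam^-1 *: (Y2 * X1);
      Y1 * Y2 - lam *: (Y2 * Y1);
      Y1 * X2 - (q1^-1 * lam^-1) *: (X2 * Y1);
      X1 * Y1 - q1 *: (Y1 * X1) - 1;
      X2 * Y2 - q2 *: (Y2 * X2) - (1 + (q1 - 1) *: (Y1 * X1))].

Definition A2 := quo weyl_rels.

Definition x1 : A2 := quo_pi weyl_rels X1.
Definition y1 : A2 := quo_pi weyl_rels Y1.
Definition x2 : A2 := quo_pi weyl_rels X2.
Definition y2 : A2 := quo_pi weyl_rels Y2.
Definition z1 : A2 := x1 * y1 - y1 * x1.
Definition z2 : A2 := x2 * y2 - y2 * x2.

(* The structure map of A2 as a K-algebra; its image is central.              *)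
Definition scal (k : K) : A2 := quo_pi weyl_rels k%:MP.

Lemma mulr_malgC (a : freeAlg) k : a * k%:MP = k *: a.
Proof.
rewrite -mul_malgC !malgM_def fgmulUg fgmulgU; apply: eq_bigr => m _.
by rewrite mulrC mul1m mulm1.
Qed.

Lemma scal_central k (a : A2) : scal k * a = a * scal k.
Proof.
elim/quo_piW: a => a; rewrite /scal.
by rewrite -!(@quo_pi_mul _ weyl_rels) mulr_malgC mul_malgC.
Qed.

Lemma scal1 : scal 1 = 1.
Proof. by rewrite /scal !rmorph1. Qed.

Lemma scalD k l : scal (k + l) = scal k + scal l.
Proof. by rewrite /scal rmorphD quo_pi_add. Qed.

Lemma scalM k l : scal (k * l) = scal k * scal l.
Proof. by rewrite /scal rmorphM quo_pi_mul. Qed.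

Lemma scal_piM k u v :
  scal k * quo_pi weyl_rels u * quo_pi weyl_rels v =
  quo_pi weyl_rels (k *: (u * v)).
Proof. by rewrite -mul_malgC !quo_pi_mul mulrA. Qed.

Lemma weyl_rel_eq k u v u' v' : u * v - k *: (u' * v') \in weyl_rels ->
  quo_pi weyl_rels u * quo_pi weyl_rels v =
  scal k * quo_pi weyl_rels u' * quo_pi weyl_rels v'.
Proof.
move=> rel; rewrite scal_piM; apply: etrans (esym (quo_pi_mul _ _ _)) _.
exact/quo_eqP/in_ideal_gen.
Qed.

Lemma weyl_rel_sub k u v u' v' w : u * v - k *: (u' * v') - w \in weyl_rels ->
  quo_pi weyl_rels u * quo_pi weyl_rels v -
  scal k * quo_pi weyl_rels u' * quo_pi weyl_rels v' = quo_pi weyl_rels w.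
Proof.
move=> rel; rewrite scal_piM -(quo_pi_mul weyl_rels u v).
by apply: etrans (esym (quo_pi_sub _ _ _)) _; apply/quo_eqP/in_ideal_gen.
Qed.

Lemma weyl_relations :
  [/\ x1 * x2 = scal (q1 * lam) * x2 * x1,
      x1 * y2 = scal lam^-1 * y2 * x1,
      y1 * y2 = scal lam * y2 * y1 &
      y1 * x2 = scal (q1^-1 * lam^-1) * x2 * y1] /\
  x1 * y1 - scal q1 * y1 * x1 = 1 /\
  x2 * y2 - scal q2 * y2 * x2 = 1 + scal (q1 - 1) * y1 * x1.
Proof.
have rel n : (n < size weyl_rels)%N -> weyl_rels`_n \in weyl_rels.
  exact: mem_nth.
split; [split | split].
- exact: weyl_rel_eq (rel 0 isT).
- exact: weyl_rel_eq (rel 1 isT).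
- exact: weyl_rel_eq (rel 2 isT).
- exact: weyl_rel_eq (rel 3 isT).
- exact: weyl_rel_sub (rel 4 isT).
- apply: etrans (weyl_rel_sub (rel 5 isT)) _.
  by apply: etrans (quo_pi_add _ _ _) _; rewrite scal_piM.
Qed.

(* The underlying K-space of a right A2-module: k acts as scal k.             *)
Definition Kspace (M : lmodType A2^c) : Type := M.

Section Kspace.
Variable M : lmodType A2^c.

HB.instance Definition _ := GRing.Zmodule.on (Kspace M).

Definition kscale (k : K) (m : Kspace M) : Kspace M := (m : M) <** scal k.

Lemma kscaleA k l m : kscale k (kscale l m) = kscale (k * l) m.
Proof. by rewrite /kscale -ractM -scalM mulrC. Qed.

Lemma kscale1 : left_id 1 kscale.
Proof. by move=> m; rewrite /kscale scal1; apply: scale1r. Qed.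

Lemma kscaleDr : right_distributive kscale +%R.
Proof. by move=> k m n; apply: scalerDr. Qed.

Lemma kscaleDl m : {morph kscale^~ m : k l / k + l}.
Proof. by move=> k l; rewrite /kscale scalD; apply: scalerDl. Qed.

HB.instance Definition _ :=
  GRing.Zmodule_isLmodule.Build K (Kspace M) kscaleA kscale1 kscaleDr kscaleDl.

Definition Kdim_eq (n : nat) : Prop := inhabited (Vector.axiom n (Kspace M)).
End Kspace.

Definition is_eigenvector (M : lmodType A2^c) (w : M) (a : A2) : Prop :=
  exists k : K, w <** a = w <** scal k.

Definition type_M2 (l1 l2 : nat) (M : lmodType A2^c)
    (eta1 xi2 zeta1 zeta2 : K) : Prop :=
  simple_module M /\
  [/\ acts_invertibly M z1, acts_invertibly M z2,
      acts_nilpotently M x1 & acts_invertibly M x2] /\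
  exists w : M,
    [/\ w != 0,
        forall c, c \in [:: x1 ^+ l1; x2 ^+ l2; y1 ^+ l1; y2 ^+ l2; z1; z2] ->
          is_eigenvector w c &
        [/\ w <** x1 = 0,
            w <** x2 ^+ l2 = w <** scal xi2,
            w <** y1 ^+ l1 = w <** scal eta1,
            w <** z1 = w <** scal zeta1 &
            w <** z2 = w <** scal zeta2]].

End QuantizedWeyl.

(* Main.v *)
Require Import Defs.
From HB Require Import structures.
From mathcomp Require Import all_boot all_order all_algebra.
From mathcomp Require Import boolp monalg ring.

Set Implicit Arguments.
Unset Strict Implicit.
Unset Printing Implicit Defensive.

Import GRing.Theory.
Local Open Scope ring_scope.

(* Let w be a vector as in the definition of the type. The vectors w y1^i x2^j
   (i < l1, j < l2) are nonzero joint eigenvectors of z1 and z2 with pairwise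
   distinct eigenvalues (q1^-(i+1), zeta2 q1^-i q2^j), hence independent, and
   their span is stable under the generators, hence is the whole simple module.
   Since w x1 = 0, the eigenvalue zeta1 is always q1^-1. An isomorphism sends w
   to a vector of the same kind in M', and the joint eigenvalues of z1, z2,
   x2^l2 and y1^l1 on the basis show that it has the eigenvalues of w' x2^b for
   some b. Conversely w' x2^b can replace w' as a generator, and the parameters
   determine the structure constants of the basis. *)

(** * Iterates of linear maps commuting up to a scalar, and separation of eigenvectors *)

Section Iterates.
Variables (K : fieldType) (V : lmodType K).
Implicit Types (f g : {linear V -> V}) (c : K) (m : V).

Lemma iterZ f c m n : iter n f (c *: m) = c *: iter n f m.
Proof. by elim: n => //= n ->; rewrite linearZ. Qed.

Lemma iter_is_linear f n : linear (iter n f).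
Proof. by move=> c u v; elim: n => //= n ->; rewrite linearP. Qed.

HB.instance Definition _ f n :=
  GRing.isLinear.Build K V V *:%R (iter n f) (iter_is_linear f n).

Lemma iter_semicomm f g c m n :
  (forall u, f (g u) = c *: g (f u)) ->
  f (iter n g m) = c ^+ n *: iter n g (f m).
Proof.
move=> fg; elim: n => [|n IHn] /=; first by rewrite expr0 scale1r.
by rewrite fg IHn linearZ scalerA exprS.
Qed.

Lemma iter_iter_semicomm f g c m n p :
  (forall u, f (g u) = c *: g (f u)) ->
  iter p f (iter n g m) = c ^+ (n * p) *: iter n g (iter p f m).
Proof.
move=> fg; elim: p => [|p IHp] /=; first by rewrite muln0 expr0 scale1r.
by rewrite IHp linearZ /= (iter_semicomm _ _ fg) scalerA -exprD -mulnSr.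
Qed.

(* Apply the product of all T - b', for b' != b an eigenvalue: it kills every
   eigenvector except those for b, which it rescales. *)
Lemma eigen_component (I : finType) (P : pred I) (T : {linear V -> V})
    (a : I -> K) (v : I -> V) (b : K) :
  (forall k, T (v k) = a k *: v k) -> \sum_(k | P k) v k = 0 ->
  \sum_(k | P k && (a k == b)) v k = 0.
Proof.
move=> Tv sum0; pose F s u := foldr (fun b' u => T u - b' *: u) u s.
have F_sum s : F s (\sum_(k | P k) v k) =
    \sum_(k | P k) (\prod_(b' <- s) (a k - b')) *: v k.
  elim: s => [|b' s IHs] /=.
    by apply: eq_bigr => k _; rewrite big_nil scale1r.
  rewrite IHs linear_sum scaler_sumr -sumrB; apply: eq_bigr => k _.
  by rewrite linearZ /= Tv big_cons !scalerA -scalerBl mulrC mulrBl.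
have F0 s : F s 0 = 0 by elim: s => //= b' s ->; rewrite linear0 scaler0 subr0.
pose s := [seq b' <- [seq a k | k <- enum I] | b' != b].
have /(congr1 (F s)) := sum0; rewrite F_sum F0.
rewrite (bigID (fun k => a k == b)) /= [X in _ + X]big1 ?addr0; last first.
  move=> k /andP[_ neq]; apply/eqP; rewrite scaler_eq0; apply/orP; left.
  have sk : a k \in s by rewrite mem_filter neq map_f ?mem_enum.
  by rewrite (big_rem _ sk) /= subrr mul0r.
rewrite (eq_bigr (fun k => (\prod_(b' <- s) (b - b')) *: v k)); last first.
  by move=> k /andP[_ /eqP->].
rewrite -scaler_sumr => /eqP; rewrite scaler_eq0 => /orP[|/eqP//].
rewrite prodf_seq_eq0 => /hasP[b']; rewrite mem_filter => /andP[neq _] /=.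
by rewrite subr_eq0 eq_sym (negPf neq).
Qed.

End Iterates.

(** The maps stand for right multiplications, so composition reverses the factors: the product x1 x2
    becomes [X2 (X1 m)]. Stating the relations for operators on a K-space keeps the computations
    below free of the quotient ring. *)
Record weyl_action (K : fieldType) (q1 q2 lam : K) (V : lmodType K)
    (X1 Y1 X2 Y2 : V -> V) : Prop := WeylAction {
  weyl_x1x2 : forall m, X2 (X1 m) = (q1 * lam) *: X1 (X2 m);
  weyl_x1y2 : forall m, Y2 (X1 m) = lam^-1 *: X1 (Y2 m);
  weyl_y1y2 : forall m, Y2 (Y1 m) = lam *: Y1 (Y2 m);
  weyl_y1x2 : forall m, X2 (Y1 m) = (q1^-1 * lam^-1) *: Y1 (X2 m);
  weyl_x1y1 : forall m, Y1 (X1 m) - q1 *: X1 (Y1 m) = m;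
  weyl_x2y2 : forall m,
    Y2 (X2 m) - q2 *: X2 (Y2 m) = m + (q1 - 1) *: X1 (Y1 m) }.

(* No eigenvalue of z1 is recorded: w x1 = 0 forces it to be q1^-1. *)
Record M2_vector (K : fieldType) (l1 l2 : nat) (V : lmodType K)
    (X1 Y1 X2 Y2 : V -> V) (eta xi zeta : K) (w : V) : Prop := M2Vector {
  M2_x1 : X1 w = 0;
  M2_x2 : iter l2 X2 w = xi *: w;
  M2_y1 : iter l1 Y1 w = eta *: w;
  M2_z2 : Y2 (X2 w) - X2 (Y2 w) = zeta *: w }.

(** * The normal elements z1 and z2 as linear operators *)

Section ZMaps.
Variables (K : fieldType) (q1 : K) (V : lmodType K).
Variables X1 Y1 X2 Y2 : {linear V -> V}.

(* z1 equals 1 + (q1 - 1) y1 x1 because x1 y1 = 1 + q1 y1 x1. *)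
Definition z1_map (m : V) : V := m + (q1 - 1) *: X1 (Y1 m).
Definition z2_map (m : V) : V := Y2 (X2 m) - X2 (Y2 m).

Fact z1_map_is_linear : linear z1_map.
Proof.
by move=> c m n; rewrite /z1_map !linearP /= addrACA -scalerDr.
Qed.

Fact z2_map_is_linear : linear z2_map.
Proof. by move=> c m n; rewrite /z2_map !linearP /= addrACA -scalerDr. Qed.

HB.instance Definition _ :=
  GRing.isLinear.Build K V V *:%R z1_map z1_map_is_linear.
HB.instance Definition _ :=
  GRing.isLinear.Build K V V *:%R z2_map z2_map_is_linear.

End ZMaps.

(** * Commutation of z1 and z2 with y1 and x2 *)

Section M2Vectors.
Variables (K : fieldType) (q1 q2 lam : K) (l1 l2 : nat).
Hypotheses (q1_neq0 : q1 != 0) (q1_neq1 : q1 != 1).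
Hypotheses (q2_neq1 : q2 != 1) (lam_neq0 : lam != 0).
Hypotheses (q1_prim : l1.-primitive_root q1) (q2_prim : l2.-primitive_root q2).
Hypothesis (lam_l1 : lam ^+ l1 = 1).
Variables (V : lmodType K) (X1 Y1 X2 Y2 : {linear V -> V}).
Hypothesis act : weyl_action q1 q2 lam X1 Y1 X2 Y2.

Local Notation Z1 := (z1_map q1 X1 Y1).
Local Notation Z2 := (z2_map X2 Y2).

Let q1lam_neq0 : q1 * lam != 0. Proof. by rewrite mulf_neq0. Qed.

Lemma z1_mapE m : Z1 m = m + (q1 - 1) *: X1 (Y1 m). Proof. by []. Qed.

Lemma z1_map_x1y1 m : Z1 m = Y1 (X1 m) - X1 (Y1 m).
Proof.
have /(canRL (subrK _)) -> := weyl_x1y1 act m.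
by rewrite z1_mapE scalerBl scale1r addrA.
Qed.

Lemma weyl_x2y1 m : Y1 (X2 m) = (q1 * lam) *: X2 (Y1 m).
Proof. by rewrite (weyl_y1x2 act) scalerA -invfM mulrC mulVf ?scale1r. Qed.

Lemma weyl_x2x1 m : X1 (X2 m) = (q1 * lam)^-1 *: X2 (X1 m).
Proof. by rewrite (weyl_x1x2 act) scalerA mulVf ?scale1r. Qed.

(** Substituting x1 y1 = 1 + q1 y1 x1 in the middle of y1 x1 y1 turns z1 y1 into q1 y1 z1. *)
Lemma z1_map_Y1 m : Z1 (Y1 m) = q1^-1 *: Y1 (Z1 m).
Proof.
have /(canRL (subrK _)) E := weyl_x1y1 act (Y1 m).
rewrite z1_mapE [in RHS]z1_mapE linearD linearZ scalerDr scalerA /=.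
set u := Y1 (X1 (Y1 m)) in E *; set v := X1 (Y1 (Y1 m)) in E *.
have -> : u = Y1 m + q1 *: v by rewrite E.
rewrite scalerDr scalerA addrA -scalerDl.
have -> : q1^-1 + q1^-1 * (q1 - 1) = 1 by field.
by rewrite scale1r mulrAC mulVf ?mul1r.
Qed.

(** The factors q1 lam met in moving x2 past y1 and then past x1 cancel. *)
Lemma z1_map_X2 m : Z1 (X2 m) = X2 (Z1 m).
Proof.
rewrite !z1_mapE linearD linearZ /= weyl_x2y1 linearZ /= (weyl_x1x2 act).
by rewrite scalerA.
Qed.

(** The right-hand side of the last relation is z1, so that relation reads x2 y2 - q2 y2 x2 = z1. *)
Lemma z2_map_z1 m : Z2 m = Z1 m + (q2 - 1) *: X2 (Y2 m).
Proof.
by rewrite z1_mapE -(weyl_x2y2 act) scalerBl scale1r addrA subrK.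
Qed.

Lemma z2_map_Y1 m : Z2 (Y1 m) = q1^-1 *: Y1 (Z2 m).
Proof.
rewrite !z2_map_z1 z1_map_Y1 [in RHS]linearD [in RHS]linearZ /= scalerDr.
congr (_ + _).
rewrite (weyl_y1y2 act) linearZ /= (weyl_y1x2 act) !scalerA; congr (_ *: _).
by field; rewrite q1_neq0.
Qed.

(** Since z1 commutes with x2, x2 z1 = z1 x2 = (x2 y2 - q2 y2 x2) x2; adding (q2 - 1) x2 y2 x2
    leaves q2 z2 x2. *)
Lemma z2_map_X2 m : Z2 (X2 m) = q2 *: X2 (Z2 m).
Proof.
have Z1X2 : Z1 (X2 m) = X2 (Y2 (X2 m)) - q2 *: X2 (X2 (Y2 m)).
  by rewrite z1_map_X2 z1_mapE -(weyl_x2y2 act) linearB linearZ.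
rewrite z2_map_z1 Z1X2 /z2_map linearB scalerBr addrAC scalerBl scale1r.
by rewrite [X in X - _]addrC subrK.
Qed.

(** Both z1 and z2 are combinations of x2 y2 and y2 x2; this solves for x2 y2. Hence y2 undoes x2 up
    to a scalar on joint eigenvectors of z1 and z2. *)
Lemma Y2_X2 m : Y2 (X2 m) = (q2 - 1)^-1 *: (q2 *: Z2 m - Z1 m).
Proof.
have -> : q2 *: Z2 m - Z1 m = (q2 - 1) *: Y2 (X2 m).
  rewrite z1_mapE -(weyl_x2y2 act) /z2_map [q2 *: (_ - _)]scalerBr opprB addrA.
  by rewrite subrK scalerBl scale1r.
by rewrite scalerA mulVf ?scale1r ?subr_eq0.
Qed.

(** * Action of the generators on the vectors w y1^i x2^j *)

Variables (eta xi zeta : K) (w : V).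
Hypothesis w_M2 : M2_vector l1 l2 X1 Y1 X2 Y2 eta xi zeta w.

(* This is w y1^i x2^j; basis_period1 and basis_period2 reduce arbitrary i, j
   to the l1 * l2 basis vectors with i < l1 and j < l2. *)
Definition M2_basis (i j : nat) : V := iter j X2 (iter i Y1 w).
Local Notation e := M2_basis.

Lemma Y1_basis i j : Y1 (e i j) = (q1 * lam) ^+ j *: e i.+1 j.
Proof. by rewrite /e (iter_semicomm _ _ weyl_x2y1). Qed.

Lemma z1_map_w : Z1 w = q1^-1 *: w.
Proof.
rewrite z1_mapE; have := weyl_x1y1 act w; rewrite (M2_x1 w_M2) linear0 sub0r.
set p := X1 _ => <-; rewrite !scalerN scalerA mulVf // scale1r.
by rewrite scalerBl scale1r addKr.
Qed.

Lemma z1_map_basis i j : Z1 (e i j) = q1 ^- i.+1 *: e i j.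
Proof.
have Z1X2 u : Z1 (X2 u) = 1 *: X2 (Z1 u) by rewrite z1_map_X2 scale1r.
rewrite /e (iter_semicomm _ _ Z1X2) expr1n scale1r.
rewrite (iter_semicomm _ _ z1_map_Y1) /= z1_map_w !iterZ scalerA.
by rewrite exprVn exprSr invfM mulrC.
Qed.

Lemma z2_map_basis i j : Z2 (e i j) = (zeta * q1 ^- i * q2 ^+ j) *: e i j.
Proof.
rewrite /e (iter_semicomm _ _ z2_map_X2) (iter_semicomm _ _ z2_map_Y1) /=.
rewrite [Z2 w](M2_z2 w_M2) !iterZ !scalerA exprVn; congr (_ *: _).
by rewrite mulrC mulrAC mulrA mulrAC.
Qed.

Lemma X1_basis0 j : X1 (e 0 j) = 0.
Proof.
rewrite /e (iter_semicomm _ _ weyl_x2x1) /= (M2_x1 w_M2).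
by rewrite linear0 scaler0.
Qed.

(** Up to the factor from moving y1 past x2^j, [e i.+1 j] is y1 applied to [e i j], and y1 x1 = (z1
    - 1) / (q1 - 1) acts on [e i j] by a scalar. *)
Lemma X1_basisS i j :
  X1 (e i.+1 j) =
  ((q1 * lam) ^- j * ((q1 - 1)^-1 * (q1 ^- i.+1 - 1))) *: e i j.
Proof.
have -> : e i.+1 j = (q1 * lam) ^- j *: Y1 (e i j).
  by rewrite Y1_basis scalerA mulVf ?scale1r ?expf_neq0.
have : X1 (Y1 (e i j)) = (q1 - 1)^-1 *: (Z1 (e i j) - e i j).
  by rewrite z1_mapE [_ - e _ _]addrC addKr scalerA mulVf ?scale1r ?subr_eq0.
rewrite linearZ /= => ->; rewrite z1_map_basis -!scalerA; congr (_ *: (_ *: _)).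
by rewrite scalerBl scale1r.
Qed.

Lemma Y2_basisS i j : exists c, Y2 (e i j.+1) = c *: e i j.
Proof.
exists ((q2 - 1)^-1 * (q2 * (zeta * q1 ^- i * q2 ^+ j) - q1 ^- i.+1)).
rewrite /M2_basis iterS Y2_X2 -/(M2_basis i j) z2_map_basis z1_map_basis.
by rewrite scalerA -scalerBl scalerA.
Qed.

(** Moving x2^l2 past y1^i costs a scalar, so the eigenvalue depends on i; it is [xi] on the row i =
    0, the one used to compare parameters. *)
Lemma X2_basis_period i j :
  iter l2 X2 (e i j) = ((q1 * lam) ^- (i * l2) * xi) *: e i j.
Proof.
rewrite /e -iterD addnC iterD (iter_iter_semicomm _ _ _ (weyl_y1x2 act)).
by rewrite (M2_x2 w_M2) !iterZ scalerA -invfM exprVn.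
Qed.

Lemma basis_period2 i j :
  e i (j + l2) = ((q1 * lam) ^- (i * l2) * xi) *: e i j.
Proof. by rewrite /e addnC iterD X2_basis_period. Qed.

Lemma basis_period1 i j : e (i + l1) j = eta *: e i j.
Proof. by rewrite /e iterD (M2_y1 w_M2) !iterZ. Qed.

(** Here the eigenvalue is the same everywhere: q1^l1 = lam^l1 = 1 makes y1^l1 commute with x2. *)
Lemma Y1_basis_period i j : iter l1 Y1 (e i j) = eta *: e i j.
Proof.
rewrite /e (iter_iter_semicomm _ _ _ weyl_x2y1) mulnC exprM exprMn lam_l1.
rewrite (prim_expr_order q1_prim) mul1r expr1n scale1r -iterD addnC iterD.
by rewrite (M2_y1 w_M2) !iterZ.
Qed.

(** * The span of the basis vectors and its stability under the generators *)

Lemma basis_ind (P : nat -> nat -> Prop) :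
    (forall i j, i < l1 -> j < l2 -> P i j)%N ->
    (forall i j, P i j -> P (i + l1)%N j) ->
    (forall i j, P i j -> P i (j + l2)%N) ->
  forall i j, P i j.
Proof.
move=> Plt P1 P2 i j.
have {P2} Plt1 i' : (i' < l1)%N -> P i' j.
  move=> lti'; rewrite (divn_eq j l2); elim: (j %/ l2)%N => [|n IHn].
    by rewrite mul0n; apply: Plt; rewrite ?ltn_mod ?(prim_order_gt0 q2_prim).
  by rewrite mulSn -addnA addnC; apply: P2.
rewrite (divn_eq i l1); elim: (i %/ l1)%N => [|n IHn].
  by rewrite mul0n; apply: Plt1; rewrite ltn_mod (prim_order_gt0 q1_prim).
by rewrite mulSn -addnA addnC; apply: P1.
Qed.

Definition M2_comb (r : 'M[K]_(l1, l2)) : V := \sum_i \sum_j r i j *: e i j.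

Lemma M2_comb_is_linear : linear M2_comb.
Proof.
move=> c r s; rewrite /M2_comb scaler_sumr -big_split; apply: eq_bigr => i _.
rewrite scaler_sumr -big_split; apply: eq_bigr => j _.
by rewrite !mxE scalerDl scalerA.
Qed.

HB.instance Definition _ :=
  GRing.isLinear.Build K 'M[K]_(l1, l2) V *:%R M2_comb M2_comb_is_linear.

Definition in_M2_span (u : V) : Prop := exists r, u = M2_comb r.

Lemma in_M2_span0 : in_M2_span 0.
Proof. by exists 0; rewrite linear0. Qed.

Lemma in_M2_spanZ c u : in_M2_span u -> in_M2_span (c *: u).
Proof. by move=> [r ->]; exists (c *: r); rewrite linearZ. Qed.

Lemma in_M2_spanD u v : in_M2_span u -> in_M2_span v -> in_M2_span (u + v).
Proof. by move=> [r ->] [s ->]; exists (r + s); rewrite linearD. Qed.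

Lemma M2_comb_delta (i : 'I_l1) (j : 'I_l2) : M2_comb (delta_mx i j) = e i j.
Proof.
rewrite /M2_comb (bigD1 i) //= (bigD1 j) //= mxE !eqxx scale1r !big1 ?addr0 //.
  move=> i' neq; rewrite big1 // => j' _.
  by rewrite mxE (negPf neq) scale0r.
by move=> j' neq; rewrite mxE (negPf neq) andbF scale0r.
Qed.

Lemma in_M2_span_basis i j : in_M2_span (e i j).
Proof.
move: i j; apply: basis_ind => [i j lti ltj | i j | i j].
- by exists (delta_mx (Ordinal lti) (Ordinal ltj)); rewrite M2_comb_delta.
- by move=> ?; rewrite basis_period1; apply: in_M2_spanZ.
- by move=> ?; rewrite basis_period2; apply: in_M2_spanZ.
Qed.

Lemma in_M2_span_stable (T : {linear V -> V}) u :
  (forall i j, in_M2_span (T (e i j))) -> in_M2_span u -> in_M2_span (T u).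
Proof.
move=> Te [r ->]; rewrite linear_sum.
elim/big_ind: _ => [||i _]; [exact: in_M2_span0 | exact: in_M2_spanD |].
rewrite linear_sum; elim/big_ind: _ => [||j _].
- exact: in_M2_span0.
- exact: in_M2_spanD.
- by rewrite linearZ; apply: in_M2_spanZ.
Qed.

Lemma in_M2_span_gens u : xi != 0 -> in_M2_span u ->
  [/\ in_M2_span (X1 u), in_M2_span (Y1 u),
      in_M2_span (X2 u) & in_M2_span (Y2 u)].
Proof.
move=> xi_neq0 Iu.
have YS i j : in_M2_span (Y2 (e i j.+1)).
  by have [c ->] := Y2_basisS i j; apply/in_M2_spanZ/in_M2_span_basis.
split; apply: in_M2_span_stable Iu => i j.
- case: i => [|i]; first by rewrite X1_basis0; apply: in_M2_span0.
  by rewrite X1_basisS; apply/in_M2_spanZ/in_M2_span_basis.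
- by rewrite Y1_basis; apply/in_M2_spanZ/in_M2_span_basis.
- exact: (in_M2_span_basis i j.+1).
(* The column j = 0 has no predecessor. As [xi] is nonzero, [e i 0] is a multiple of [e i l2], and
   y2 sends the latter to a multiple of [e i l2.-1]. *)
- case: j => [|j]; last exact: YS.
  have c_neq0 : (q1 * lam) ^- (i * l2) * xi != 0.
    by rewrite mulf_neq0 ?invr_eq0 ?expf_neq0.
  have -> : e i 0 = ((q1 * lam) ^- (i * l2) * xi)^-1 *: e i l2.
    by rewrite -[l2 in RHS]add0n basis_period2 scalerA mulVf ?scale1r.
  rewrite linearZ; apply: in_M2_spanZ.
  by rewrite -(prednK (prim_order_gt0 q2_prim)).
Qed.

(** * Linear independence of the basis vectors and uniqueness of the parameters *)

Hypotheses (w_neq0 : w != 0) (xi_neq0 : xi != 0) (zeta_neq0 : zeta != 0).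

(** In the column j = 0, x1 leads from [e i.+1 0] back to a multiple of [e i 0], nonzero because
    q1^(i+1) differs from 1 for i + 1 < l1. Along a row, further powers of x2 lead from [e i j] to
    [e i l2], a nonzero multiple of [e i 0]. *)
Lemma basis_neq0 i j : (i < l1)%N -> (j < l2)%N -> e i j != 0.
Proof.
move=> lti ltj.
have ei0 : e i 0 != 0.
  elim: i lti => [|i IHi] // lti; have := IHi (ltnW lti).
  apply: contraNneq => ei0; have := X1_basisS i 0.
  rewrite ei0 linear0 => /esym/eqP; rewrite scaler_eq0 => /orP[|/eqP //].
  rewrite !mulf_eq0 !invr_eq0 expf_eq0 /= subr_eq0 (negPf q1_neq1) /=.
  rewrite subr_eq0 -[1]invr1 (can_eq invrK) -(expr0 q1).
  by rewrite (eq_prim_root_expr q1_prim) mod0n modn_small.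
apply: contra_neq ei0 => eij.
have : e i l2 = 0.
  rewrite -(subnK (ltnW ltj)) /e iterD -/(e i j) eij.
  by rewrite linear0.
rewrite -[l2]add0n basis_period2 => /eqP; rewrite scaler_eq0.
rewrite mulf_eq0 invr_eq0 (negPf xi_neq0) expf_eq0 (negPf q1lam_neq0) andbF.
by move=> /eqP.
Qed.

Lemma M2_comb_eq0 r : M2_comb r = 0 -> r = 0.
Proof.
move=> r0; apply/matrixP => i j; rewrite mxE.
pose v (p : 'I_l1 * 'I_l2) := r p.1 p.2 *: e p.1 p.2.
have {r0} r0 : \sum_(p | true) v p = 0 by rewrite -[RHS]r0 /M2_comb pair_big.
have Z1v p : Z1 (v p) = q1 ^- p.1.+1 *: v p.
  by rewrite linearZ /= z1_map_basis !scalerA mulrC.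
have Z2v p : Z2 (v p) = (zeta * q1 ^- p.1 * q2 ^+ p.2) *: v p.
  by rewrite linearZ /= z2_map_basis !scalerA mulrC.
(* z1 isolates the row i; within that row the eigenvalues of z2 are distinct and isolate the column
   j. *)
have := eigen_component (zeta * q1 ^- i * q2 ^+ j) Z2v
  (eigen_component (q1 ^- i.+1) Z1v r0).
rewrite (big_pred1 (i, j)) => [/eqP|[i' j'] /=].
  by rewrite scaler_eq0 (negPf (basis_neq0 _ _)) ?orbF // => /eqP.
rewrite (can_eq invrK) (eq_prim_root_expr q1_prim) -addn1 -[i.+1]addn1.
rewrite eqn_modDr !modn_small // -[_ == i :> nat]/(i' == i) xpair_eqE.
have [->|//] := eqVneq i' i; rewrite /=.
rewrite (inj_eq (mulfI _)) ?mulf_neq0 ?invr_eq0 ?expf_neq0 //.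
by rewrite (eq_prim_root_expr q2_prim) !modn_small.
Qed.

Lemma M2_comb_inj : injective M2_comb.
Proof.
move=> r s eqrs; apply/eqP; rewrite -subr_eq0; apply/eqP/M2_comb_eq0.
by rewrite linearB /= eqrs subrr.
Qed.

(** Applying T - b multiplies each coefficient [r i j] by [a i j - b], and independence makes all
    these products vanish. *)
Lemma M2_comb_eigen (T : {linear V -> V}) (a : 'I_l1 -> 'I_l2 -> K) b
    (r : 'M[K]_(l1, l2)) :
  (forall (i : 'I_l1) (j : 'I_l2), T (e i j) = a i j *: e i j) ->
  T (M2_comb r) = b *: M2_comb r -> forall i j, r i j != 0 -> a i j = b.
Proof.
move=> Te Tr i j rij.
have : M2_comb (\matrix_(i, j) ((a i j - b) * r i j)) = 0.
  rewrite -(subrr (b *: M2_comb r)) -{1}Tr linear_sum.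
  rewrite scaler_sumr -sumrB; apply: eq_bigr => i' _.
  rewrite linear_sum scaler_sumr -sumrB; apply: eq_bigr => j' _.
  by rewrite mxE linearZ /= Te !scalerA -scalerBl mulrBl [r _ _ * _]mulrC.
move/M2_comb_eq0/matrixP/(_ i j)/eqP; rewrite !mxE mulf_eq0 (negPf rij) orbF.
by rewrite subr_eq0 => /eqP.
Qed.

(** Since u x1 = 0, z1 acts on u by q1^-1, so u is supported on the row i = 0. The eigenvalues of
    y1^l1, x2^l2 and z2 on u can then be read off at any basis vector [e 0 j] occurring in u. *)
Lemma M2_vector_eq eta' xi' zeta' u :
  u != 0 -> in_M2_span u -> M2_vector l1 l2 X1 Y1 X2 Y2 eta' xi' zeta' u ->
  [/\ eta' = eta, xi' = xi & exists2 j, (j < l2)%N & zeta' = zeta * q2 ^+ j].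
Proof.
move=> u_neq0 [r def_u]; rewrite def_u in u_neq0 * => u_M2.
have [[i j] /= rij | r0] := pickP (fun p => r p.1 p.2 != 0); last first.
  case/eqP: u_neq0; rewrite (_ : r = 0) ?linear0 //.
  by apply/matrixP => i j; rewrite mxE; have /eqP := r0 (i, j).
have i0 : i = 0%N :> nat.
  have Z1u : Z1 (M2_comb r) = q1^-1 *: M2_comb r.
    rewrite z1_map_x1y1; have := weyl_x1y1 act (M2_comb r).
    rewrite (M2_x1 u_M2) linear0 !sub0r => {2}<-.
    by rewrite scalerN scalerA mulVf ?scale1r.
  have := M2_comb_eigen (fun i j => z1_map_basis i j) Z1u rij.
  move/invr_inj/eqP; rewrite -{2}[q1]expr1 (eq_prim_root_expr q1_prim) -addn1.
  by rewrite -{2}[1%N]add0n eqn_modDr mod0n modn_small // => /eqP.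
split.
- exact/esym/(M2_comb_eigen (fun i j => Y1_basis_period i j) (M2_y1 u_M2) rij).
- have := M2_comb_eigen (fun i j => X2_basis_period i j) (M2_x2 u_M2) rij.
  by rewrite i0 mul0n expr0 invr1 mul1r.
- exists j => //.
  have := M2_comb_eigen (fun i j => z2_map_basis i j) (M2_z2 u_M2) rij.
  by rewrite i0 expr0 divr1.
Qed.

(** This supplies the generator w x2^j behind the factor q2^b in the isomorphism criterion. *)
Lemma M2_vector_basis0 j :
  M2_vector l1 l2 X1 Y1 X2 Y2 eta xi (zeta * q2 ^+ j) (e 0 j).
Proof.
split; first exact: X1_basis0.
- by rewrite X2_basis_period mul0n expr0 invr1 mul1r.
- exact: Y1_basis_period.
- by rewrite [LHS]z2_map_basis expr0 divr1.
Qed.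

End M2Vectors.

(** * From right modules over the algebra to operators on the underlying K-space *)

Section A2Modules.
Variables (K : fieldType) (q1 q2 lam : K).
Local Notation A2 := (A2 q1 q2 lam).
Local Notation x1 := (x1 q1 q2 lam).
Local Notation y1 := (y1 q1 q2 lam).
Local Notation x2 := (x2 q1 q2 lam).
Local Notation y2 := (y2 q1 q2 lam).
Local Notation z1 := (z1 q1 q2 lam).
Local Notation z2 := (z2 q1 q2 lam).
Local Notation scal := (scal q1 q2 lam).

(** Every element lifts to the free algebra, where it is a sum of scalar multiples of words, and
    words are built letter by letter. *)
Lemma A2_ind (P : A2 -> Prop) :
    (forall k, P (scal k)) ->
    (forall a b, P a -> P b -> P (a + b)) ->
    (forall a b, P a -> P b -> P (a * b)) ->
    P x1 -> P y1 -> P x2 -> P y2 ->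
  forall a, P a.
Proof.
move=> Pscal PD PM Px1 Py1 Px2 Py2; elim/quo_piW => g.
rewrite (monalgE g) raddf_sum.
elim/big_ind: _ => [||m _].
- by have := Pscal 0; rewrite /scal malgC0E raddf0.
- exact: PD.
have Pgen i : P (quo_pi (weyl_rels q1 q2 lam) (gen K i)).
  case: i => [[|[|[|[|n]]]] lti]; last by case: (notF lti).
  - rewrite (bool_irrelevance lti isT); exact: Px1.
  - rewrite (bool_irrelevance lti isT); exact: Py1.
  - rewrite (bool_irrelevance lti isT); exact: Px2.
  - rewrite (bool_irrelevance lti isT); exact: Py2.
pose U s : freeAlg K := mkmalgU (FMonom s : fmonom 'I_4) 1.
have PU (s : seq 'I_4) : P (quo_pi (weyl_rels q1 q2 lam) (U s)).
  elim: s => [|i s IHs]; first by rewrite /U -fmoneE; apply: Pscal 1.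
  have -> : U (i :: s) = gen K i * U s.
    rewrite /U /gen malgM_def fgmulUU mul1r; congr (mkmalgU _ _).
    by rewrite [RHS]fmmulE fmuE.
  rewrite quo_pi_mul; exact: PM (Pgen i) IHs.
have -> : mkmalgU m (mcoeff m g) = mkmalgU one (mcoeff m g) * mkmalgU m 1.
  by rewrite malgM_def fgmulUU mulr1 mul1m.
rewrite /= quo_pi_mul; apply: (PM _ _ (Pscal _)).
case: m => s; exact: PU.
Qed.

Section Action.
Variable M : lmodType A2^c.

Definition ract_map (a : A2) (m : Kspace M) : Kspace M := (m : M) <** a.

Lemma ract_mapM a b m : ract_map (a * b) m = ract_map b (ract_map a m).
Proof. exact: (@ractM _ M m a b). Qed.

Lemma ract_mapD a b m : ract_map (a + b) m = ract_map a m + ract_map b m.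
Proof. exact: (@scalerDl _ M m (a : A2^c) b). Qed.

Lemma ract_mapB a b m : ract_map (a - b) m = ract_map a m - ract_map b m.
Proof. exact: (@scalerBl _ M (a : A2^c) b m). Qed.

Lemma ract_map1 m : ract_map 1 m = m.
Proof. exact: (@scale1r _ M m). Qed.

Lemma ract_map_scal k m : ract_map (scal k) m = k *: m.
Proof. by []. Qed.

(** K-linearity of right multiplication is the centrality of [scal]. *)
Fact ract_map_is_linear a : linear (ract_map a).
Proof.
move=> k m n; rewrite -!ract_map_scal -!ract_mapM -scal_central ract_mapM.
exact: (@scalerDr _ M (a : A2^c)).
Qed.

HB.instance Definition _ a :=
  GRing.isLinear.Build K (Kspace M) (Kspace M) *:%R (ract_map a)
    (ract_map_is_linear a).

Lemma ract_mapX a n m : ract_map (a ^+ n) m = iter n (ract_map a) m.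
Proof.
elim: n => [|n IHn]; first by rewrite expr0 ract_map1.
by rewrite exprSr ract_mapM IHn.
Qed.

Lemma ract_map_scalMM k (a b : A2) m :
  ract_map (scal k * a * b) m = k *: ract_map b (ract_map a m).
Proof.
rewrite (ract_mapM (scal k * a) b) (ract_mapM (scal k) a).
by rewrite (ract_map_scal k m) [ract_map a _]linearZ linearZ.
Qed.

Lemma ract_map_semicomm (a b c d : A2) k m :
  a * b = scal k * c * d ->
  ract_map b (ract_map a m) = k *: ract_map d (ract_map c m).
Proof. by move=> ab; rewrite -ract_mapM ab ract_map_scalMM. Qed.

Lemma ract_map_qcommutator (a b c : A2) k m :
  a * b - scal k * b * a = c ->
  ract_map b (ract_map a m) - k *: ract_map a (ract_map b m) = ract_map c m.
Proof.
move=> <-; apply/esym; apply: etrans (ract_mapB _ _ _) _.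
exact: congr2 (ract_mapM _ _ _) (congr1 -%R (ract_map_scalMM _ _ _ _)).
Qed.

Lemma ract_map_commutator (a b : A2) m :
  ract_map (a * b - b * a) m =
  ract_map b (ract_map a m) - ract_map a (ract_map b m).
Proof.
apply: etrans (ract_mapB _ _ _) _.
exact: congr2 (ract_mapM _ _ _) (congr1 -%R (ract_mapM _ _ _)).
Qed.

Lemma ract_map1D (a b : A2) k m :
  ract_map (1 + scal k * a * b) m = m + k *: ract_map b (ract_map a m).
Proof. by rewrite ract_mapD ract_map_scalMM ract_map1. Qed.

Lemma weyl_action_ract :
  weyl_action q1 q2 lam (ract_map x1) (ract_map y1) (ract_map x2) (ract_map y2).
Proof.
have [[r1 r2 r3 r4] [r5 r6]] := weyl_relations q1 q2 lam.
split=> m.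
- exact: ract_map_semicomm r1.
- exact: ract_map_semicomm r2.
- exact: ract_map_semicomm r3.
- exact: ract_map_semicomm r4.
- exact: etrans (ract_map_qcommutator m r5) (ract_map1 m).
- exact: etrans (ract_map_qcommutator m r6) (ract_map1D _ _ _ m).
Qed.

End Action.
End A2Modules.

(** * Modules with a generating vector: homomorphisms, coordinates and isomorphisms *)

Section TypeM2.
Variables (K : fieldType) (q1 q2 lam : K) (l1 l2 : nat).
Hypotheses (q1_neq0 : q1 != 0) (q1_neq1 : q1 != 1).
Hypotheses (q2_neq1 : q2 != 1) (lam_neq0 : lam != 0).
Hypotheses (q1_prim : l1.-primitive_root q1) (q2_prim : l2.-primitive_root q2).
Hypothesis (lam_l1 : lam ^+ l1 = 1).
Local Notation A2 := (A2 q1 q2 lam).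
Local Notation x1 := (x1 q1 q2 lam).
Local Notation y1 := (y1 q1 q2 lam).
Local Notation x2 := (x2 q1 q2 lam).
Local Notation y2 := (y2 q1 q2 lam).
Local Notation z1 := (z1 q1 q2 lam).
Local Notation z2 := (z2 q1 q2 lam).

Definition M2_generator (M : lmodType A2^c) : K -> K -> K -> Kspace M -> Prop :=
  M2_vector l1 l2 (@ract_map _ _ _ _ M x1) (ract_map y1) (ract_map x2)
    (ract_map y2).

Definition gen_comb (M : lmodType A2^c) (w : Kspace M) :
    'M[K]_(l1, l2) -> Kspace M :=
  M2_comb (ract_map y1) (ract_map x2) w.

HB.instance Definition _ M w := GRing.Linear.on (@gen_comb M w).

Section Linear.
Variables (M N : lmodType A2^c) (f : {linear M -> N}).
Let fK : Kspace M -> Kspace N := f.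

Lemma ract_map_linear a m : fK (ract_map a m) = ract_map a (fK m).
Proof. exact: (linearZZ f (a : A2^c) m). Qed.

Lemma iter_ract_map_linear n a m :
  fK (iter n (ract_map a) m) = iter n (ract_map a) (fK m).
Proof. by elim: n => //= n IHn; rewrite ract_map_linear IHn. Qed.

Lemma Kspace_linear : linear fK.
Proof.
move=> k m n; rewrite -!ract_map_scal -ract_map_linear.
exact: (linearD f).
Qed.

Lemma gen_comb_linear w r : fK (gen_comb w r) = gen_comb (fK w) r.
Proof.
pose fl : {linear Kspace M -> Kspace N} := HB.pack_for
  {linear Kspace M -> Kspace N} fK
  (GRing.isLinear.Build _ _ _ _ fK Kspace_linear).
rewrite -[fK]/(fl : _ -> _) /gen_comb /M2_comb linear_sum.
apply: eq_bigr => i _; rewrite linear_sum; apply: eq_bigr => j _.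
by rewrite linearZ /= /M2_basis !iter_ract_map_linear.
Qed.

Lemma M2_generator_linear eta xi zeta w :
  M2_generator eta xi zeta w -> M2_generator eta xi zeta (fK w).
Proof.
case=> wx1 wx2 wy1 wz2; split.
- by rewrite -ract_map_linear wx1; apply: (linear0 f).
- by rewrite -iter_ract_map_linear wx2 -!ract_map_scal ract_map_linear.
- by rewrite -iter_ract_map_linear wy1 -!ract_map_scal ract_map_linear.
- rewrite -!ract_map_commutator in wz2 *.
  by rewrite -ract_map_linear wz2 -!ract_map_scal ract_map_linear.
Qed.

End Linear.

Lemma ract_map_pair (M N : lmodType A2^c) a (m : Kspace M) (n : Kspace N) :
  @ract_map _ _ _ _ (M * N)%type a (m, n) = (ract_map a m, ract_map a n).
Proof. exact: erefl. Qed.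

(** The span is stable under the four generators, hence under the whole algebra by [A2_ind]. [M] is
    not assumed simple, so that the lemma also applies to a product of two modules. *)
Lemma gen_comb_stable (M : lmodType A2^c) eta xi zeta (w : Kspace M)
    (a : A2) r :
  xi != 0 -> M2_generator eta xi zeta w ->
  exists s, ract_map a (gen_comb w r) = gen_comb w s.
Proof.
move=> xi_neq0 w_gen; rewrite -/(in_M2_span _ _ _ _ _ _).
have gens u := in_M2_span_gens q1_neq0 q1_neq1 q2_neq1 lam_neq0 q1_prim q2_prim
  (weyl_action_ract M) w_gen (u := u) xi_neq0.
have : in_M2_span l1 l2 (ract_map y1) (ract_map x2) w (gen_comb w r).
  by exists r.
move: (gen_comb w r).
elim/A2_ind: a => [k u|a b IHa IHb u|a b IHa IHb u|u|u|u|u].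
- exact: in_M2_spanZ.
- by move=> Iu; rewrite ract_mapD; apply: in_M2_spanD; [apply: IHa|apply: IHb].
- by move=> Iu; rewrite ract_mapM; apply/IHb/IHa.
- by case/gens.
- by case/gens.
- by case/gens.
- by case/gens.
Qed.

Lemma gen_comb_surj (M : lmodType A2^c) eta xi zeta (w : Kspace M) :
  simple_module M -> w != 0 -> xi != 0 -> M2_generator eta xi zeta w ->
  forall u, exists r, u = gen_comb w r.
Proof.
move=> [_ simpM] w_neq0 xi_neq0 w_gen.
pose S : {pred M} := fun u => `[< exists r, (u : Kspace M) = gen_comb w r >].
have S_closed : submod_closed S.
  split=> [|a u v]; first by apply/asboolP; exists 0; rewrite linear0.
  move=> /asboolP[r def_u] /asboolP[s def_v]; apply/asboolP.
  have [r' def_r'] := gen_comb_stable (a : A2) r xi_neq0 w_gen.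
  exists (r' + s); rewrite linearD /= -def_v -def_r' -def_u; exact: erefl.
(* w is the basis vector with both indices 0. *)
have Sw : (w : M) \in S.
  apply/asboolP; exists (delta_mx (Ordinal (prim_order_gt0 q1_prim))
                           (Ordinal (prim_order_gt0 q2_prim))).
  by rewrite /gen_comb M2_comb_delta.
case: (simpM S S_closed) => [S0|ST u].
  by have := Sw; rewrite S0 inE (negPf (w_neq0 : (w : M) != 0)).
by have /asboolP := ST (u : M).
Qed.

Lemma gen_comb_inj (M : lmodType A2^c) eta xi zeta (w : Kspace M) :
  w != 0 -> xi != 0 -> zeta != 0 -> M2_generator eta xi zeta w ->
  injective (gen_comb w).
Proof.
move=> w_neq0 xi_neq0 zeta_neq0 w_gen.
exact: (M2_comb_inj q1_neq0 q1_neq1 lam_neq0 q1_prim q2_prim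
  (weyl_action_ract M) w_gen w_neq0 xi_neq0 zeta_neq0).
Qed.

Lemma gen_comb_coord (M : lmodType A2^c) eta xi zeta (w : Kspace M) :
    simple_module M -> w != 0 -> xi != 0 -> zeta != 0 ->
    M2_generator eta xi zeta w ->
  exists g : {linear Kspace M -> 'M[K]_(l1, l2)},
    cancel g (gen_comb w) /\ cancel (gen_comb w) g.
Proof.
move=> simpM w_neq0 xi_neq0 zeta_neq0 w_gen.
have [g gK] := choice (gen_comb_surj simpM w_neq0 xi_neq0 w_gen).
have inj := gen_comb_inj w_neq0 xi_neq0 zeta_neq0 w_gen.
(* A section of an injective linear map is linear. *)
have g_lin : linear g by move=> k u v; apply: inj; rewrite linearP /= -!gK.
exists (HB.pack_for {linear Kspace M -> 'M[K]_(l1, l2)} g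
  (GRing.isLinear.Build _ _ _ _ g g_lin)).
split=> [u | r]; first exact: (esym (gK u)).
exact: (inj _ _ (esym (gK _))).
Qed.

Lemma M2_generator_Kdim (M : lmodType A2^c) eta xi zeta (w : Kspace M) :
  simple_module M -> w != 0 -> xi != 0 -> zeta != 0 ->
  M2_generator eta xi zeta w -> Kdim_eq M (l1 * l2).
Proof.
move=> simpM w_neq0 xi_neq0 zeta_neq0 w_gen.
have [g [gK Kg]] := gen_comb_coord simpM w_neq0 xi_neq0 zeta_neq0 w_gen.
constructor; exists (mxvec \o g); first exact: linearP.
exists (gen_comb w \o vec_mx) => [u | v] /=; first by rewrite mxvecK gK.
by rewrite Kg vec_mxK.
Qed.

(* Apply gen_comb_stable to the vector (w, w') of M * N: its orbit is the graph
   of the K-linear map sending the basis of M to that of N. *)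
Lemma M2_generator_iso (M N : lmodType A2^c) eta xi zeta
    (w : Kspace M) (w' : Kspace N) :
    simple_module M -> w != 0 -> M2_generator eta xi zeta w ->
    simple_module N -> w' != 0 -> M2_generator eta xi zeta w' ->
    xi != 0 -> zeta != 0 ->
  module_iso M N.
Proof.
move=> simpM w_neq0 w_gen simpN w'_neq0 w'_gen xi_neq0 zeta_neq0.
have [g [gK Kg]] := gen_comb_coord simpM w_neq0 xi_neq0 zeta_neq0 w_gen.
have [g' [gK' Kg']] := gen_comb_coord simpN w'_neq0 xi_neq0 zeta_neq0 w'_gen.
pose P := (M * N)%type : lmodType A2^c.
pose W : Kspace P := (w, w').
have W_gen : M2_generator eta xi zeta W.
  have iterW n a (m : Kspace M) (m' : Kspace N) :
      iter n (@ract_map _ _ _ _ P a) (m, m') =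
      (iter n (ract_map a) m, iter n (ract_map a) m').
    by elim: n => //= n ->; rewrite ract_map_pair.
  case: w_gen => wx1 wx2 wy1 wz2; case: w'_gen => wx1' wx2' wy1' wz2'; split.
  - by rewrite ract_map_pair wx1 wx1'.
  - by rewrite iterW wx2 wx2'.
  - by rewrite iterW wy1 wy1'.
  - rewrite -!ract_map_commutator in wz2 wz2' *.
    by rewrite ract_map_pair wz2 wz2'.
have combW r : gen_comb W r = (gen_comb w r, gen_comb w' r).
  have := gen_comb_linear (fst : {linear P -> M}) W r.
  have := gen_comb_linear (snd : {linear P -> N}) W r.
  by case: (gen_comb W r) => u u' /= -> ->.
pose f (u : M) : N := gen_comb w' (g u).
have f_ract a u : f (ract_map a u) = ract_map a (f u).
  have [s] := gen_comb_stable a (g u) xi_neq0 W_gen.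
  rewrite !combW ract_map_pair => -[E1 E2].
  by rewrite /f E2 -[u in LHS]gK E1 Kg.
have f_lin : linear f.
  move=> a u v; rewrite -[RHS]/(ract_map (a : A2) (f u) + f v) -f_ract.
  exact: etrans (congr1 (gen_comb w') (linearD g (ract_map (a : A2) u) v))
    (linearD (gen_comb w') _ _).
exists (HB.pack_for {linear M -> N} f (GRing.isLinear.Build _ _ _ _ f f_lin)).
exists (gen_comb w \o g') => [u | v] /=; first by rewrite /f Kg' gK.
by rewrite /f Kg gK'.
Qed.

Lemma type_M2_generator (M : lmodType A2^c) eta xi zeta1 zeta2 :
  type_M2 l1 l2 M eta xi zeta1 zeta2 ->
  simple_module M /\ exists w : Kspace M,
    [/\ w != 0, M2_generator eta xi zeta2 w & zeta1 = q1^-1].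
Proof.
move=> [simpM [_ [w [w_neq0 _ [wx1 wx2 wy1 wz1 wz2]]]]]; split=> //.
have w_gen : M2_generator eta xi zeta2 (w : Kspace M).
  split; first exact: wx1.
  - by rewrite -ract_mapX; apply: wx2.
  - by rewrite -ract_mapX; apply: wy1.
  - by rewrite -ract_map_commutator; apply: wz2.
exists w; split=> //.
(* Compare the two values of w z1: [zeta1] times w by the type, q1^-1 times w because w x1 = 0. *)
have := z1_map_w q1_neq0 (weyl_action_ract M) w_gen.
rewrite (z1_map_x1y1 (weyl_action_ract M)) -ract_map_commutator.
rewrite -[ract_map _ _]/(w <** z1) wz1 -[_ <** _]/(zeta1 *: (w : Kspace M)).
move/eqP; rewrite -subr_eq0 -scalerBl scaler_eq0 subr_eq0.
by rewrite (negPf (w_neq0 : (w : Kspace M) != 0)) orbF => /eqP.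
Qed.

End TypeM2.

(** * Dimension and isomorphism criterion *)

Theorem theorem4p3 (K : closedFieldType) (q1 q2 lam : K) (l1 l2 : nat)
  (q1_neq0 : q1 != 0) (q1_neq1 : q1 != 1)
  (q2_neq0 : q2 != 0) (q2_neq1 : q2 != 1) (lam_neq0 : lam != 0)
  (q1_prim : l1.-primitive_root q1) (q2_prim : l2.-primitive_root q2)
  (lam_l1 : lam ^+ l1 = 1)
  (eta1 eta1' xi2 zeta1 zeta2 xi2' zeta1' zeta2' : K)
  (xi2_neq0 : xi2 != 0) (zeta1_neq0 : zeta1 != 0) (zeta2_neq0 : zeta2 != 0)
  (xi2'_neq0 : xi2' != 0) (zeta1'_neq0 : zeta1' != 0)
  (zeta2'_neq0 : zeta2' != 0) :
  (forall M : lmodType (A2 q1 q2 lam)^c,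
     type_M2 l1 l2 M eta1 xi2 zeta1 zeta2 -> Kdim_eq M (l1 * l2)%N) /\
  (forall M M' : lmodType (A2 q1 q2 lam)^c,
     type_M2 l1 l2 M eta1 xi2 zeta1 zeta2 ->
     type_M2 l1 l2 M' eta1' xi2' zeta1' zeta2' ->
     (module_iso M M' <->
      [/\ eta1 = eta1',
          xi2 = xi2' &
          exists a b : nat,
            [/\ (0 <= a <= l1 - 1)%N, (0 <= b <= l2 - 1)%N,
                zeta1 = q1 ^- a * zeta1' &
                zeta2 = q1 ^- a * q2 ^+ b * zeta2']])).
Proof.
split=> [M | M M'] /(type_M2_generator q1_neq0)[simpM [w [w_neq0 w_gen z1E]]].
  exact: M2_generator_Kdim simpM w_neq0 xi2_neq0 zeta2_neq0 w_gen.
move=> /(type_M2_generator q1_neq0)[simpM' [w' [w'_neq0 w'_gen z1'E]]].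
split=> [[f [g fK _]] | [eta_eq xi_eq [a [b [_ ltb q1a zetaE]]]]].
  have fw_neq0 : (f w : Kspace M') != 0.
    by rewrite -[0]/(0 : M') -(linear0 f) (inj_eq (can_inj fK)).
  have fw_gen := M2_generator_linear f w_gen.
  have fw_span := gen_comb_surj q1_neq0 q1_neq1 q2_neq1 lam_neq0 q1_prim q2_prim
    simpM' w'_neq0 xi2'_neq0 w'_gen (f w).
  have [-> -> [b ltb ->]] := M2_vector_eq q1_neq0 q1_neq1 lam_neq0 q1_prim
    q2_prim lam_l1 (weyl_action_ract M') w'_gen w'_neq0 xi2'_neq0 zeta2'_neq0
    fw_neq0 fw_span fw_gen.
  (* Both [zeta1] and [zeta1'] equal q1^-1, so a = 0 works. *)
  split=> //; exists 0%N, b; split=> //.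
  - by rewrite leq0n /= -ltnS subn1 prednK ?(prim_order_gt0 q2_prim).
  - by rewrite expr0 invr1 mul1r z1E z1'E.
  - by rewrite expr0 invr1 mul1r mulrC.
(* Conversely, [zeta1 = zeta1'] forces the factor q1^-a to be 1, which leaves [zeta2] equal to q2^b
   [zeta2']. *)
have q1a1 : q1 ^- a = 1.
  by apply: (mulIf zeta1'_neq0); rewrite -q1a mul1r z1E z1'E.
rewrite q1a1 mul1r mulrC in zetaE.
(* The vector w' x2^b of [M'] has the same parameters as w. *)
have w''_gen := M2_vector_basis0 q1_neq0 lam_neq0 q1_prim lam_l1
  (weyl_action_ract M') w'_gen b.
have w''_neq0 := basis_neq0 q1_neq0 q1_neq1 lam_neq0 q1_prim
  (weyl_action_ract M') w'_gen w'_neq0 xi2'_neq0 (prim_order_gt0 q1_prim)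
  (_ : (b < l2)%N).
rewrite -zetaE -eta_eq -xi_eq in w''_gen.
apply: (M2_generator_iso q1_neq0 q1_neq1 q2_neq1 lam_neq0 q1_prim q2_prim
  simpM w_neq0 w_gen simpM' _ w''_gen xi2_neq0 zeta2_neq0).
by apply: w''_neq0; rewrite -(prednK (prim_order_gt0 q2_prim)) ltnS -subn1.
Qed.
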